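(* Let $(M,g)$ be a connected semi-Riemannian manifold and let $I$ be an open interval. Let $\Sigma$ be a Lie group acting by isometries on $M$ and let $\pi:M\to I$ be a submersion such that the fibers of $\pi$ are orbits of the action. Assume that $g(\nabla\pi,\nabla\pi)=\widetilde\varepsilon\in\{1,-1\}$ is constant and that $\mathrm{div}(\nabla\pi)=h\circ\pi$ for some function $h:I\to\mathbb{R}$. Let $\varepsilon\in\{1,-1\}$ and assume that $\varepsilon\widetilde\varepsilon=-1$. Then, given $s_o\in I$, $f_1\in(-1,1)$ and $f_o\in\mathbb{R}$, there exists a solution $f:I\to\mathbb{R}$, defined on all of $I$, to $$f''(s)=\big(\widetilde\varepsilon+\varepsilon f'(s)^2\big)\big(1-f'(s)h(s)\big)$$ such that $f(s_o)=f_o$ and $f'(s_o)=f_1$.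
   Context: Submersions $\pi:M\to I$ are smooth and surjective; $\nabla\pi$ and $\mathrm{div}$ are taken with respect to $g$, regarding $\pi$ as a real-valued function. In particular $h$ is smooth. *)

(* Defs.v *)
(* MathComp-Analysis, over an arbitrary R : realType.

   Smooth manifolds, Lie groups and semi-Riemannian metrics in classical
   coordinate form: a manifold is a topological space with an atlas of charts
   into R^n = 'rV[R]_n, and a tensor field is the family of its components in
   the charts of the atlas.  Component families take an arbitrary chart as
   argument, but only their values on the charts of the atlas, at coordinates
   in the image of the chart, are meaningful. *)
From HB Require Import structures.
From mathcomp Require Import all_boot all_order all_algebra.
From mathcomp Require Import all_classical all_reals all_analysis.

Set Implicit Arguments.
Unset Strict Implicit.
Unset Printing Implicit Defensive.

Import Order.TTheory GRing.Theory Num.Theory.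
Import numFieldNormedType.Exports.

Local Open Scope classical_set_scope.
Local Open Scope ring_scope.

Definition partial (R : realType) (n : nat) (V : normedModType R) (i : 'I_n)
    (f : 'rV[R]_n -> V) : 'rV[R]_n -> V :=
  fun x => 'D_(delta_mx 0 i) f x.

(* f is of class C^k on U; meant for U open, where it depends only on f|U. *)
Fixpoint Ck_on (R : realType) (n : nat) (V : normedModType R) (k : nat)
    (U : set 'rV[R]_n) (f : 'rV[R]_n -> V) : Prop :=
  (forall x, U x -> {for x, continuous f}) /\
  if k is k'.+1 then
    forall i : 'I_n, (forall x, U x -> derivable f x (delta_mx 0 i)) /\
                     Ck_on k' U (partial i f)
  else True.

Definition smooth_on (R : realType) (n : nat) (V : normedModType R)
    (U : set 'rV[R]_n) (f : 'rV[R]_n -> V) : Prop :=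
  forall k, Ck_on k U f.

(* A homeomorphism between open sets; cmap and cinv are total functions with
   arbitrary values outside cdom and cmap @` cdom. *)
Record chart (R : realType) (M : topologicalType) (n : nat) := Chart {
  cdom : set M;
  cmap : M -> 'rV[R]_n;
  cinv : 'rV[R]_n -> M;
  cdom_open : open cdom;
  cimg_open : open (cmap @` cdom);
  cmapK : forall p, cdom p -> cinv (cmap p) = p;
  cmap_continuous : forall p, cdom p -> {for p, continuous cmap};
  cinv_continuous : forall x, (cmap @` cdom) x -> {for x, continuous cinv}
}.

Definition cimg (R : realType) (M : topologicalType) (n : nat)
    (c : chart R M n) : set 'rV[R]_n := cmap c @` cdom c.

(* The atlas is not required to be maximal. *)
Record manifold (R : realType) (M : topologicalType) (n : nat) := Manifold {
  atlas : set (chart R M n);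
  mfd_hausdorff : hausdorff_space M;
  mfd_second_countable : @second_countable M;
  atlas_cover : forall p, exists2 c, atlas c & cdom c p;
  atlas_compat : forall c d, atlas c -> atlas d ->
    smooth_on (cmap c @` (cdom c `&` cdom d)) (cmap d \o cinv c)
}.

Definition smooth_fun (R : realType) (M : topologicalType) (m : nat)
    (A : manifold R M m) (f : M -> R) : Prop :=
  forall c, atlas A c -> smooth_on (cimg c) (f \o cinv c).

Definition smooth_map (R : realType) (M N : topologicalType) (m n : nat)
    (A : manifold R M m) (B : manifold R N n) (f : M -> N) : Prop :=
  continuous f /\
  forall c d, atlas A c -> atlas B d ->
    smooth_on [set x | cimg c x /\ cdom d (f (cinv c x))]
              (cmap d \o f \o cinv c).

(* Smoothness of a map from the product manifold M * N, in product charts,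
   whose coordinates are the concatenations of those of M and of N. *)
Definition smooth_map2 (R : realType) (M N P : topologicalType) (m n p : nat)
    (A : manifold R M m) (B : manifold R N n) (C : manifold R P p)
    (f : M -> N -> P) : Prop :=
  continuous (fun z : M * N => f z.1 z.2) /\
  forall c d e, atlas A c -> atlas B d -> atlas C e ->
    let F (x : 'rV[R]_(m + n)) := f (cinv c (lsubmx x)) (cinv d (rsubmx x)) in
    smooth_on [set x | [/\ cimg c (lsubmx x), cimg d (rsubmx x)
                         & cdom e (F x)]]
              (cmap e \o F).

Definition diffeomorphism (R : realType) (M N : topologicalType) (m n : nat)
    (A : manifold R M m) (B : manifold R N n) (f : M -> N) : Prop :=
  smooth_map A B f /\
  exists finv : N -> M,
    [/\ cancel f finv, cancel finv f & smooth_map B A finv].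

(* A group and a topology on the same carrier; their compatibility is part of
   [lie_group]. *)
#[short(type="groupSpaceType")]
HB.structure Definition GroupSpace := {G of Topological G & Group G}.

Record lie_group (R : realType) (G : groupSpaceType) (k : nat) := LieGroup {
  lie_manifold :> manifold R G k;
  lie_mul_smooth : smooth_map2 lie_manifold lie_manifold lie_manifold
                     (fun a b : G => (a * b)%g);
  lie_inv_smooth : smooth_map lie_manifold lie_manifold (fun a : G => a^-1%g)
}.

Definition smooth_action (R : realType) (G : groupSpaceType)
    (M : topologicalType) (k n : nat) (L : lie_group R G k)
    (A : manifold R M n) (act : G -> M -> M) : Prop :=
  [/\ forall p, act 1%g p = p,
      forall a b p, act (a * b)%g p = act a (act b p)
    & smooth_map2 L A A act].

Definition act_orbit (G : groupSpaceType) (M : Type) (act : G -> M -> M) (p : M) :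
  set M := [set act a p | a in [set: G]].

Definition bilin (R : realType) (n : nat) (S : 'M[R]_n) (v w : 'rV[R]_n) : R :=
  (v *m S *m w^T) 0 0.

(* The row space of W is a negative definite subspace for S. *)
Definition neg_definite_on (R : realType) (n : nat) (S W : 'M[R]_n) : Prop :=
  forall v : 'rV[R]_n, (v <= W)%MS -> v != 0 -> bilin S v v < 0.

Definition has_index (R : realType) (n : nat) (S : 'M[R]_n) (nu : nat) : Prop :=
  (exists2 W : 'M[R]_n, neg_definite_on S W & \rank W = nu) /\
  (forall W : 'M[R]_n, neg_definite_on S W -> (\rank W <= nu)%N).

(* metric g c x is the Gram matrix (g_ij) of the coordinate frame of the chart
   c at the point with coordinates x. *)
Record semi_riemannian (R : realType) (M : topologicalType) (n : nat)
    (A : manifold R M n) := SemiRiemannian {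
  metric : chart R M n -> 'rV[R]_n -> 'M[R]_n;
  metric_smooth : forall c, atlas A c -> forall i j : 'I_n,
    smooth_on (cimg c) (fun x => metric c x i j);
  metric_sym : forall c x, atlas A c -> cimg c x -> forall v w,
    bilin (metric c x) v w = bilin (metric c x) w v;
  metric_nondegenerate : forall c x, atlas A c -> cimg c x -> forall v,
    (forall w, bilin (metric c x) v w = 0) -> v = 0;
  metric_index : exists nu : nat, forall c x, atlas A c -> cimg c x ->
    has_index (metric c x) nu;
  metric_change : forall c d, atlas A c -> atlas A d ->
    forall x, cimg c x -> cdom d (cinv c x) ->
    let F := cmap d \o cinv c in
    forall v w, bilin (metric d (F x)) ('d F x v) ('d F x w) =
                bilin (metric c x) v w
}.

Definition metric_isometry (R : realType) (M : topologicalType) (n : nat)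
    (A : manifold R M n) (g : semi_riemannian A) (f : M -> M) : Prop :=
  diffeomorphism A A f /\
  forall c d, atlas A c -> atlas A d ->
  forall x, cimg c x -> cdom d (f (cinv c x)) ->
    let F := cmap d \o f \o cinv c in
    forall v w, bilin (metric g d (F x)) ('d F x v) ('d F x w) =
                bilin (metric g c x) v w.

(* A vector field is given by its components: X c x is the row of the X^i. *)
Definition vector_field (R : realType) (M : topologicalType) (n : nat) :=
  chart R M n -> 'rV[R]_n -> 'rV[R]_n.

(* (grad f)^i = sum_j g^ij d_j f *)
Definition grad (R : realType) (M : topologicalType) (n : nat)
    (A : manifold R M n) (g : semi_riemannian A) (f : M -> R) : vector_field R M n :=
  fun c x => (\row_j partial j (f \o cinv c) x) *m invmx (metric g c x).

(* Gamma^k_ij of the Levi-Civita connection: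
   1/2 sum_m g^km (d_i g_jm + d_j g_im - d_m g_ij) *)
Definition christoffel (R : realType) (M : topologicalType) (n : nat)
    (A : manifold R M n) (g : semi_riemannian A) (c : chart R M n)
    (x : 'rV[R]_n) (k i j : 'I_n) : R :=
  2^-1 * \sum_(m < n) invmx (metric g c x) k m *
    (partial i (fun y => metric g c y j m) x
     + partial j (fun y => metric g c y i m) x
     - partial m (fun y => metric g c y i j) x).

(* Entry (i, k) is the k-th component of the covariant derivative of X along
   the i-th coordinate field: d_i X^k + sum_j Gamma^k_ij X^j. *)
Definition cov_deriv (R : realType) (M : topologicalType) (n : nat)
    (A : manifold R M n) (g : semi_riemannian A) (X : vector_field R M n)
    (c : chart R M n) (x : 'rV[R]_n) : 'M[R]_n :=
  \matrix_(i < n, k < n) (partial i (fun y => X c y 0 k) x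
    + \sum_(j < n) christoffel g c x k i j * X c x 0 j).

Definition divergence (R : realType) (M : topologicalType) (n : nat)
    (A : manifold R M n) (g : semi_riemannian A) (X : vector_field R M n)
    (c : chart R M n) (x : 'rV[R]_n) : R :=
  \tr (cov_deriv g X c x).

Definition open_interval (R : realType) (I : set R) : Prop :=
  open I /\ is_interval I.

Definition submersion_onto (R : realType) (M : topologicalType) (n : nat)
    (A : manifold R M n) (I : set R) (f : M -> R) : Prop :=
  [/\ smooth_fun A f,
      f @` [set: M] = I
    & forall c x, atlas A c -> cimg c x ->
        forall t : R, exists v, 'd (f \o cinv c) x v = t].

Lemma metric_unit (R : realType) (M : topologicalType) (n : nat)
    (A : manifold R M n) (g : semi_riemannian A) c x :
  atlas A c -> cimg c x -> metric g c x \in unitmx.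
Proof.
move=> Ac cx; rewrite -row_free_unit -kermx_eq0; apply/eqP/row_matrixP => i.
rewrite row0; apply: (metric_nondegenerate (s := g) Ac cx) => w.
by rewrite /bilin -row_mul mulmx_ker row0 mul0mx mxE.
Qed.

(* g(grad f, w) = df(w) *)
Lemma grad_metric (R : realType) (M : topologicalType) (n : nat)
    (A : manifold R M n) (g : semi_riemannian A) (f : M -> R) c x w :
  atlas A c -> cimg c x ->
  bilin (metric g c x) (grad g f c x) w =
  \sum_(j < n) partial j (f \o cinv c) x * w 0 j.
Proof.
move=> Ac cx; rewrite /bilin /grad mulmxKV; last exact: metric_unit Ac cx.
by rewrite mxE; apply: eq_bigr => j _; rewrite !mxE.
Qed.

(* Main.v *)
Require Import Defs.
From mathcomp Require Import all_boot all_order all_algebra.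
From mathcomp Require Import all_classical all_reals all_analysis.
From mathcomp Require Import ring lra.

Set Implicit Arguments.
Unset Strict Implicit.
Unset Printing Implicit Defensive.

Import Order.TTheory GRing.Theory Num.Theory.
Import numFieldNormedType.Exports.

Local Open Scope classical_set_scope.
Local Open Scope ring_scope.

(** Put [w = f']. Since [eps = - epst], the equation reads
    [w' = epst (1 - w^2) (1 - w h)], so [w = 1] and [w = -1] are barriers, and the
    substitution [w = tanh th] turns it into [th' = epst (1 - tanh th * h)].
    The right-hand side is Lipschitz in [th] with constant [|h s|], which is
    bounded on every compact subinterval of [I]; hence [th] exists on the whole
    of [I] ([lipschitz_ode_solution]), so does [w] ([abel_ode_solution]), and
    [f] is a primitive of [w].

    The geometry enters through the continuity of [h] on [I]
    ([divergence_factor_continuous]). In a chart [c], the divergence of the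
    gradient is a rational expression in the derivatives of [prj] and of the
    metric, with a nonvanishing denominator, hence a continuous function
    ([divergence_continuous]). As [g(grad prj, grad prj)] does not vanish, some
    partial derivative of [prj] does not vanish at a given point, so along the
    corresponding coordinate line [prj] takes all the values close to its value
    at that point, and [h] inherits the continuity of the divergence along this
    line ([continuous_from_curve]).

    Global existence is proved by Picard iteration carried out on the whole of
    [I] at once. On a compact subinterval where the Lipschitz constant is at
    most [M], one step halves distances measured with the weight
    [expR (2 * M * |s - so|)] ([picard_contract]), whatever the length of the
    subinterval. The iterates therefore converge locally uniformly on [I], and
    no gluing of local solutions is needed. *)

(** * Functions of class C^1 and the continuity of the divergence *)

Section C1.
Context {R : realType} {n : nat} {U : set 'rV[R]_n}.
Hypothesis Uo : open U.
Implicit Types f g : 'rV[R]_n -> R.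

Lemma near_open x : U x -> \forall y \near x, U y.
Proof. by move=> Ux; apply: open_nbhs_nbhs; split. Qed.

Lemma continuous_at_near (T : topologicalType) (x : T) (f g : T -> R) :
  (\forall y \near x, f y = g y) ->
  {for x, continuous f} -> {for x, continuous g}.
Proof.
move=> fg fc; suff : g @ x --> g x by [].
by rewrite -(nbhs_singleton fg); apply: cvg_trans fc; exact: near_eq_cvg.
Qed.

(** [Ck_on] speaks of the iterated partial derivatives as total functions; since
    [U] is open, it suffices that they agree on [U] with continuous functions. *)
Lemma Ck1_intro f (df : 'I_n -> 'rV[R]_n -> R) :
  (forall x, U x -> {for x, continuous f}) ->
  (forall i x, U x -> is_derive x (delta_mx 0 i) f (df i x)) ->
  (forall i x, U x -> {for x, continuous (df i)}) ->
  Ck_on 1 U f.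
Proof.
move=> fc fd dfc; split=> // i; split=> [x Ux|]; first by have [] := fd i x Ux.
split=> // x Ux; apply: continuous_at_near (dfc i x Ux).
near=> y; have Uy : U y by near: y; exact: near_open.
by rewrite /partial; have [_ ->] := fd i y Uy.
Unshelve. all: by end_near. Qed.

Lemma Ck1_is_derive f i x : Ck_on 1 U f -> U x ->
  is_derive x (delta_mx 0 i) f (partial i f x).
Proof. by move=> [_ /(_ i)[fd _]] Ux; apply: derivableP; exact: fd. Qed.

Lemma Ck1_continuous f x : Ck_on 1 U f -> U x -> {for x, continuous f}.
Proof. by case=> fc _; exact: fc. Qed.

Lemma Ck1_continuous_partial f i x : Ck_on 1 U f -> U x ->
  {for x, continuous (partial i f)}.
Proof. by move=> [_ /(_ i)[_ [fc _]]]; exact: fc. Qed.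

Lemma Ck1_eq f g : (forall x, U x -> f x = g x) -> Ck_on 1 U f -> Ck_on 1 U g.
Proof.
move=> fg f1.
have nfg x : U x -> \forall y \near x, f y = g y.
  by move=> Ux; near=> y; apply: fg; near: y; exact: near_open.
apply: (@Ck1_intro _ (fun i => partial i f)) => [x Ux|i x Ux|i x Ux].
- exact: continuous_at_near (nfg x Ux) (Ck1_continuous f1 Ux).
- exact: near_eq_is_derive (nfg x Ux) (Ck1_is_derive i f1 Ux).
- exact: Ck1_continuous_partial.
Unshelve. all: by end_near. Qed.

Lemma Ck1_cst (a : R) : Ck_on 1 U (cst a).
Proof.
by apply: (@Ck1_intro _ (fun=> cst 0)) => *; exact: cst_continuous.
Qed.

Lemma Ck1D f g : Ck_on 1 U f -> Ck_on 1 U g -> Ck_on 1 U (f + g).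
Proof.
move=> f1 g1.
apply: (@Ck1_intro _ (fun i => partial i f + partial i g)) => [x Ux|i x Ux|i x Ux].
- by apply: continuousD; exact: Ck1_continuous.
- by apply: is_deriveD; exact: Ck1_is_derive.
- by apply: continuousD; exact: Ck1_continuous_partial.
Qed.

Lemma Ck1M f g : Ck_on 1 U f -> Ck_on 1 U g -> Ck_on 1 U (f * g).
Proof.
move=> f1 g1; apply: (@Ck1_intro _ (fun i =>
  (f \* partial i g) + (g \* partial i f))) => [x Ux|i x Ux|i x Ux].
- by apply: continuousM; exact: Ck1_continuous.
- by apply: is_deriveM; exact: Ck1_is_derive.
- have [fc gc] := (Ck1_continuous f1 Ux, Ck1_continuous g1 Ux).
  have [fc' gc'] :=
    (Ck1_continuous_partial (i := i) f1 Ux, Ck1_continuous_partial (i := i) g1 Ux).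
  by apply: continuousD; exact: continuousM.
Qed.

Lemma Ck1V f : (forall x, U x -> f x != 0) ->
  Ck_on 1 U f -> Ck_on 1 U (fun x => (f x)^-1).
Proof.
move=> f0 f1; apply: (@Ck1_intro _ (fun i =>
  (fun x => - ((f x)^-1 * (f x)^-1)) \* partial i f)) => [x Ux|i x Ux|i x Ux].
- by apply: continuousV; [exact: f0|exact: Ck1_continuous].
- have fd := Ck1_is_derive i f1 Ux.
  apply: DeriveDef; first by apply: derivableV; [exact: f0|exact: ex_derive].
  rewrite deriveV; [|exact: f0|exact: ex_derive].
  by rewrite derive_val -exprVn expr2.
- apply: continuousM; last exact: Ck1_continuous_partial.
  apply: continuousN; apply: continuousM;
    by apply: continuousV; [exact: f0|exact: Ck1_continuous].
Qed.

Lemma Ck1_sum (J : Type) (r : seq J) (F : J -> 'rV[R]_n -> R) :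
  (forall j, Ck_on 1 U (F j)) -> Ck_on 1 U (fun x => \sum_(j <- r) F j x).
Proof.
move=> F1; rewrite -fct_sumE.
apply: big_ind; [exact: (Ck1_cst 0)|exact: Ck1D|by move=> j _; exact: F1].
Qed.

Lemma Ck1_prod (J : Type) (r : seq J) (F : J -> 'rV[R]_n -> R) :
  (forall j, Ck_on 1 U (F j)) -> Ck_on 1 U (fun x => \prod_(j <- r) F j x).
Proof.
move=> F1; rewrite -fct_prodE.
apply: big_ind; [exact: (Ck1_cst 1)|exact: Ck1M|by move=> j _; exact: F1].
Qed.

Lemma Ck1_det m (B : 'rV[R]_n -> 'M[R]_m) :
  (forall i j, Ck_on 1 U (fun x => B x i j)) -> Ck_on 1 U (fun x => \det (B x)).
Proof.
move=> B1; apply: Ck1_sum => s; apply: Ck1M; first exact: Ck1_cst.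
by apply: Ck1_prod => i; exact: B1.
Qed.

(** Cramer's rule. The formula holds on [U] only: off the invertible matrices,
    [invmx] is the identity. *)
Lemma Ck1_invmx m (B : 'rV[R]_n -> 'M[R]_m) :
  (forall i j, Ck_on 1 U (fun x => B x i j)) ->
  (forall x, U x -> B x \in unitmx) ->
  forall i j, Ck_on 1 U (fun x => invmx (B x) i j).
Proof.
move=> B1 Bu i j.
apply: (@Ck1_eq (fun x => (\det (B x))^-1 * \adj (B x) i j)) => [x Ux|].
  by rewrite /invmx Bu// !mxE.
apply: Ck1M; first apply: Ck1V.
- by move=> x /Bu; rewrite unitmxE unitfE.
- exact: Ck1_det.
- apply: (@Ck1_eq (fun x => (-1) ^+ (j + i) * \det (row' j (col' i (B x))))).
    by move=> x Ux; rewrite !mxE.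
  apply: Ck1M; first exact: Ck1_cst.
  apply: Ck1_det => p q.
  apply: (@Ck1_eq (fun x => B x (lift j p) (lift i q))) => [x _|]; last exact: B1.
  by rewrite !mxE.
Qed.

Lemma continuous_at_sum (J : Type) (r : seq J) (F : J -> 'rV[R]_n -> R) x :
  (forall j, {for x, continuous (F j)}) ->
  {for x, continuous (fun y => \sum_(j <- r) F j y)}.
Proof.
move=> Fc; rewrite -fct_sumE; apply: big_ind.
- exact: (@cst_continuous _ _ (0 : R)).
- by move=> f g fc gc; exact: continuousD.
- by move=> j _; exact: Fc.
Qed.

End C1.

Section divergence_continuity.
Context {R : realType} {M : topologicalType} {n : nat} {A : manifold R M n}.
Variable g : semi_riemannian A.
Context {c : chart R M n}.
Hypothesis Ac : atlas A c.

Let cimgo : open (cimg c). Proof. exact: cimg_open. Qed.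

Lemma metric_Ck1 i j : Ck_on 1 (cimg c) (fun x => metric g c x i j).
Proof. exact: (metric_smooth g Ac). Qed.

Lemma invmx_metric_Ck1 i j :
  Ck_on 1 (cimg c) (fun x => invmx (metric g c x) i j).
Proof.
apply: Ck1_invmx => //; first exact: metric_Ck1.
by move=> x; exact: metric_unit.
Qed.

Lemma grad_Ck1 (f : M -> R) k : Ck_on 2 (cimg c) (f \o cinv c) ->
  Ck_on 1 (cimg c) (fun x => grad g f c x 0 k).
Proof.
move=> [_ f2].
apply: (@Ck1_eq _ _ _ cimgo (fun x =>
  \sum_j partial j (f \o cinv c) x * invmx (metric g c x) j k)) => [x _|].
  by rewrite /grad mxE; apply: eq_bigr => j _; rewrite mxE.
apply: (Ck1_sum cimgo) => j; apply: (Ck1M cimgo); last exact: invmx_metric_Ck1.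
by have [] := f2 j.
Qed.

Lemma christoffel_continuous x k i j : cimg c x ->
  {for x, continuous (fun y => christoffel g c y k i j)}.
Proof.
move=> cx; apply: continuousM; first exact: cst_continuous.
apply: continuous_at_sum => m; apply: continuousM.
  exact: Ck1_continuous (invmx_metric_Ck1 _ _) cx.
apply: continuousB; first apply: continuousD;
  exact: Ck1_continuous_partial (metric_Ck1 _ _) cx.
Qed.

(** The trace is a polynomial in the components of [X] and their first
    derivatives and, through the Christoffel symbols, in the entries of the
    inverse metric and the first derivatives of the metric; all are continuous. *)
Lemma divergence_continuous (X : vector_field R M n) x :
  (forall k, Ck_on 1 (cimg c) (fun y => X c y 0 k)) -> cimg c x ->
  {for x, continuous (fun y => divergence g X c y)}.
Proof.
move=> X1 cx; apply: continuous_at_sum => i.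
have -> : (fun y => cov_deriv g X c y i i) =
  (partial i (fun y => X c y 0 i)) \+
  (fun y => \sum_(j < n) christoffel g c y i i j * X c y 0 j).
  by apply/funext => y; rewrite mxE.
apply: continuousD; first exact: Ck1_continuous_partial (X1 i) cx.
apply: continuous_at_sum => j; apply: continuousM.
  exact: christoffel_continuous.
exact: Ck1_continuous (X1 j) cx.
Qed.

End divergence_continuity.

(** * One-variable calculus: curves, increments and primitives *)

Section real_line.
Context {R : realType}.
Implicit Types (I : set R) (f u v U V : R -> R).

(** As [phi] has a nonzero derivative at [0], the values [phi (- t)] and [phi t]
    lie on either side of [phi 0] for small [t]. By the intermediate value
    theorem every [v] near [phi 0] is [phi z] with [z] small, so [h v] is close
    to [h (phi 0)]. *)
Lemma continuous_from_curve (phi h : R -> R) (a : R) : a != 0 ->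
  t^-1 * (phi t - phi 0) @[t --> 0^'] --> a ->
  (\forall t \near 0, {for t, continuous phi}) ->
  {for 0, continuous (h \o phi)} -> {for phi 0, continuous h}.
Proof.
move=> a0 dphi phic hphic; apply/cvgrPdist_lt => e e0.
have na : 0 < `|a| by rewrite normr_gt0.
have near_a : \forall t \near 0, t != 0 -> `|a - t^-1 * (phi t - phi 0)| < `|a|.
  by move/cvgrPdist_lt : dphi => /(_ _ na); rewrite near_withinE.
have near_h : \forall t \near 0, `|h (phi 0) - h (phi t)| < e.
  by move/cvgrPdist_lt : hphic => /(_ _ e0).
have : \forall t \near 0, [/\ t != 0 -> `|a - t^-1 * (phi t - phi 0)| < `|a|,
    `|h (phi 0) - h (phi t)| < e & {for t, continuous phi}].
  near=> t; split; first by near: t.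
    by near: t.
  by near: t.
move/nbhs_ballP => [d /= d0 dball].
have dP t : `|t| < d -> [/\ t != 0 -> `|a - t^-1 * (phi t - phi 0)| < `|a|,
    `|h (phi 0) - h (phi t)| < e & {for t, continuous phi}].
  by move=> td; apply: dball; rewrite /ball/= sub0r normrN.
(* The difference quotient is closer to a than 0 is, so it has the sign of a. *)
have same_sign t : `|t| < d -> t != 0 -> 0 < (t^-1 * (phi t - phi 0)) * a.
  move=> td t0; have [/(_ t0)+ _ _] := dP t td.
  have [a_gt|a_lt|a_eq] := ltgtP 0 a; last by rewrite -a_eq eqxx in a0.
    rewrite (gtr0_norm a_gt) ltr_norml => /andP[_ ?].
    by apply: mulr_gt0 => //; lra.
  rewrite (ltr0_norm a_lt) ltr_norml => /andP[? _].
  by rewrite nmulr_lgt0//; lra.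
pose t := d / 2.
have t0 : 0 < t by rewrite divr_gt0.
have td : `|t| < d by rewrite gtr0_norm// /t; lra.
have := same_sign t td (lt0r_neq0 t0).
have := same_sign (- t); rewrite normrN oppr_eq0 => /(_ td (lt0r_neq0 t0)).
rewrite invrN !mulNr -!mulrA oppr_gt0 pmulr_rlt0 ?invr_gt0//.
rewrite (pmulr_rgt0 _ (x := t^-1)) ?invr_gt0// => sgN sgP.
have between : Num.min (phi (- t)) (phi t) < phi 0 < Num.max (phi (- t)) (phi t).
  rewrite gt_min lt_max.
  have [a_gt|a_lt|a_eq] := ltgtP 0 a; last by rewrite -a_eq eqxx in a0.
    move: sgN sgP; rewrite pmulr_llt0// pmulr_lgt0// subr_lt0 subr_gt0.
    by move=> -> ->; rewrite orbT.
  move: sgN sgP; rewrite nmulr_llt0// nmulr_lgt0// subr_lt0 subr_gt0.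
  by move=> -> ->; rewrite orbT.
have small z : - t <= z -> z <= t -> `|z| < d.
  move=> z1 z2; apply: le_lt_trans td.
  by rewrite (gtr0_norm t0) ler_norml z1.
have phic_t : {within `[- t, t], continuous phi}.
  apply: continuous_in_subspaceT => z; rewrite inE/= in_itv/= => /andP[z1 z2].
  by have [] := dP z (small z z1 z2).
have Ntt : - t <= t by lra.
have : \forall v \near phi 0,
    Num.min (phi (- t)) (phi t) < v < Num.max (phi (- t)) (phi t).
  near=> v; apply/andP; split; near: v.
    by apply: lt_nbhsr; case/andP: between.
  by apply: lt_nbhsl; case/andP: between.
apply: filterS => v /andP[/ltW v1 /ltW v2].
have [|z] := IVT Ntt phic_t (v := v); first by rewrite v1.
rewrite in_itv/= => /andP[z1 z2] <-.
by have [] := dP z (small z z1 z2).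
Unshelve. all: by end_near. Qed.

Lemma is_derive1_continuous f (s l : R) :
  is_derive s 1 f l -> {for s, continuous f}.
Proof.
by move=> [fd _]; apply: differentiable_continuous; exact/derivable1_diffP.
Qed.

(** The mean value inequality with a variable bound: [V - U] and [V + U] are
    nondecreasing. *)
Lemma increment_le U V u v (a b : R) : a <= b ->
  (forall t, a <= t <= b -> is_derive t 1 U (u t)) ->
  (forall t, a <= t <= b -> is_derive t 1 V (v t)) ->
  (forall t, a <= t <= b -> `|u t| <= v t) ->
  `|U b - U a| <= V b - V a.
Proof.
move=> ab dU dV uv.
have incr (W w : R -> R) : (forall t, a <= t <= b -> is_derive t 1 W (w t)) ->
    (forall t, a <= t <= b -> 0 <= w t) -> W a <= W b.
  move=> dW w0; have [t tab|t tab|c cab e] := @MVT_segment R W w a b ab.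
  - by apply: dW; rewrite !ltW ?(itvP tab).
  - apply: continuous_in_subspaceT => x; rewrite inE/= in_itv/= => xab.
    exact: is_derive1_continuous (dW x xab).
  - by rewrite -subr_ge0 e mulr_ge0 ?subr_ge0// w0// !(itvP cab).
have h1 : V a - U a <= V b - U b.
  apply: (incr (V - U) (fun t => v t - u t)) => t tab.
    by apply: is_deriveB; [exact: dV|exact: dU].
  by have := uv t tab; rewrite ler_norml subr_ge0 => /andP[].
have h2 : V a + U a <= V b + U b.
  apply: (incr (V + U) (fun t => v t + u t)) => t tab.
    by apply: is_deriveD; [exact: dV|exact: dU].
  by have := uv t tab; rewrite ler_norml -subr_ge0 opprK addrC => /andP[].
by rewrite ler_norml; apply/andP; split; lra.
Qed.

Lemma open_interval_widen I (s t : R) : open_interval I -> I s -> I t ->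
  exists a b, [/\ a < s < b, a < t < b & forall z, a <= z <= b -> I z].
Proof.
move=> [Io Ii] Is It.
have widen x : I x -> exists2 d, 0 < d & forall z, `|x - z| < d -> I z.
  by move=> Ix; have /nbhs_ballP[d] := open_nbhs_nbhs (conj Io Ix); exists d.
have [d d0 dI] := widen s Is; have [e e0 eI] := widen t It.
exists (Num.min (s - d / 2) (t - e / 2)), (Num.max (s + d / 2) (t + e / 2)).
have h1 : I (s - d / 2) by apply: dI; rewrite opprB addrC subrK gtr0_norm; lra.
have h2 : I (t - e / 2) by apply: eI; rewrite opprB addrC subrK gtr0_norm; lra.
have h3 : I (s + d / 2).
  by apply: dI; rewrite opprD addrA subrr sub0r normrN gtr0_norm; lra.
have h4 : I (t + e / 2).
  by apply: eI; rewrite opprD addrA subrr sub0r normrN gtr0_norm; lra.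
split.
- by rewrite gt_min lt_max; apply/andP; split; apply/orP; left; lra.
- by rewrite gt_min lt_max; apply/andP; split; apply/orP; right; lra.
- by apply: Ii; [case: leP|case: leP].
Qed.

Notation mu := (@lebesgue_measure R).

(** The integral of [f] from [so] to [s] with its sign: of the two segments, one
    is empty or reduced to a point. *)
Definition primitive (so : R) f (s : R) : R :=
  (\int[mu]_(t in `[so, s]) f t - \int[mu]_(t in `[s, so]) f t)%R.

Lemma primitive_start so f : primitive so f so = 0.
Proof. by rewrite /primitive subrr. Qed.

(** Chasles' relation with a base point [a] to the left of both [so] and [s], from
    which the fundamental theorem of calculus applies in a neighborhood of [s]. *)
Lemma primitive_shift so f a b s : mu.-integrable `[a, b] (EFin \o f) ->
  a <= so <= b -> a <= s <= b ->
  primitive so f s = \int[mu]_(t in `[a, s]) f t - \int[mu]_(t in `[a, so]) f t.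
Proof.
move=> fi.
have sub_itv x y : a <= x -> y <= b -> mu.-integrable `[x, y] (EFin \o f).
  move=> ax yb; apply: integrableS fi => //.
  by apply: subset_itv; rewrite bnd_simp.
have chasles x y : a <= x -> x <= y -> y <= b -> \int[mu]_(t in `[a, y]) f t -
    \int[mu]_(t in `[a, x]) f t = \int[mu]_(t in `[x, y]) f t.
  move=> ax xy yb; rewrite Rintegral_itvB ?bnd_simp//; last exact: sub_itv.
  rewrite Rintegral_itv_obnd_cbnd//.
  apply: integrableS (sub_itv x y ax yb) => //.
  by apply: subset_itvr; rewrite bnd_simp.
have rev x y : y <= x -> \int[mu]_(t in `[x, y]) f t = 0.
  rewrite le_eqVlt => /predU1P[->|yx]; first by rewrite set_itv1 Rintegral_set1.
  by rewrite set_itv_ge ?Rintegral_set0// bnd_simp -ltNge.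
move=> /andP[a1 b1] /andP[a2 b2]; rewrite /primitive.
have [le_so|/ltW le_s] := leP so s.
  by rewrite (rev s so)// subr0 chasles.
by rewrite (rev so s)// sub0r -chasles// opprB.
Qed.

Lemma primitive_derive I f (so s : R) : open_interval I ->
  (forall x, I x -> {for x, continuous f}) -> I so -> I s ->
  is_derive s 1 (primitive so f) (f s).
Proof.
move=> oI fc Iso Is.
have [a [b [/andP[a1 b1] /andP[a2 b2] abI]]] := open_interval_widen oI Iso Is.
have fi : mu.-integrable `[a, b] (EFin \o f).
  apply: continuous_compact_integrable; first exact: segment_compact.
  apply: continuous_in_subspaceT => x; rewrite inE/= in_itv/= => xab.
  by apply: fc; exact: abI.
have [//|dG eG] := @continuous_FTC1 R f (BLeft a) s b b2 fi _ (fc s Is).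
apply: (@near_eq_is_derive _ _ _ (fun x => \int[mu]_(t in `[a, x]) f t
    - \int[mu]_(t in `[a, so]) f t)); last first.
  rewrite -[X in is_derive _ _ _ X]subr0.
  apply: is_deriveB.
  by rewrite derive1E in eG; exact: DeriveDef dG eG.
near=> x; rewrite (primitive_shift fi)//; first by rewrite !ltW.
by apply/andP; split; apply/ltW; near: x; [exact: lt_nbhsr|exact: lt_nbhsl].
Unshelve. all: by end_near. Qed.

(** The limit is the supremum of the nondecreasing sequence [x n - e n], with
    [e n = 2 * K / 2 ^+ n] the sum of the remaining increments; the sequence
    [x n + e n] is nonincreasing and bounds it from above. *)
Lemma geometric_limit (x : nat -> R) (K : R) :
  (forall n, `|x n.+1 - x n| <= K / 2 ^+ n) ->
  exists l, forall n, `|l - x n| <= 2 * K / 2 ^+ n.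
Proof.
move=> dx.
have K0 : 0 <= K.
  by have := dx 0; rewrite expr0 divr1; exact: le_trans.
pose e n : R := 2 * K / 2 ^+ n.
have eS n : e n - e n.+1 = K / 2 ^+ n.
  rewrite /e exprS invfM; field; exact: expf_neq0.
have e0 n : 0 <= e n by rewrite /e divr_ge0 ?mulr_ge0// exprn_ge0.
have up n : x n.+1 + e n.+1 <= x n + e n.
  by have := dx n; rewrite -eS ler_norml => /andP[_ ?]; lra.
have lo n : x n - e n <= x n.+1 - e n.+1.
  by have := dx n; rewrite -eS ler_norml => /andP[? _]; lra.
have upm m n : (m <= n)%N -> x n + e n <= x m + e m.
  by move=> mn; have /nonincreasing_seqP := up; exact.
have lom m n : (m <= n)%N -> x m - e m <= x n - e n.
  by move=> mn; have /nondecreasing_seqP := lo; exact.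
have lo_up m n : x m - e m <= x n + e n.
  have [mn|/ltnW nm] := leqP m n.
    by apply: le_trans (lom _ _ mn) _; have := e0 n; lra.
  by apply: le_trans _ (upm _ _ nm); have := e0 m; lra.
pose S := range (fun n => x n - e n).
have S0 : S !=set0 by exists (x 0%N - e 0%N), 0%N.
have Sub n : ubound S (x n + e n) by move=> _ [m _ <-]; exact: lo_up.
exists (sup S) => n; rewrite -/(e n) ler_norml; apply/andP; split.
  rewrite lerNl opprB lerBlDr addrC -lerBlDr; apply: ub_le_sup.
    by exists (x 0%N + e 0%N); exact: Sub.
  by exists n.
by rewrite lerBlDl; apply: ge_sup => //; exact: Sub.
Qed.

Lemma is_derive_expR_affine (k s0 K s : R) :
  is_derive s 1 (fun t => K * expR (k * (t - s0))) (K * (k * expR (k * (s - s0)))).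
Proof.
have d1 : is_derive s 1 (fun t : R => k * (t - s0)) k.
  have d0 : is_derive s 1 (k \*: (id \- cst s0) : R -> R) (k *: (1 - 0)).
    exact: is_deriveZ.
  by rewrite subr0 [_ *: _]mulr1 in d0.
have d2 : is_derive s 1 (expR \o (fun t => k * (t - s0)))
    (expR (k * (s - s0)) * k).
  exact: is_derive1_comp.
have d3 := is_deriveZ K d2.
by apply: is_derive_eq d3 _; rewrite [_ *: _]/(K * _) (mulrC k).
Qed.

(** Integrating a bound of the form [K * k * expR (k * |t - so|)] gains a factor
    [1 / k]: this is what makes the Picard operator a contraction in an
    exponentially weighted norm. To the left of [so] the bound is the derivative
    of [- K * expR (- k * (t - so))]. *)
Lemma exp_increment_le U u (so s k K : R) : 0 <= K ->
  U so = 0 ->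
  (forall t, Num.min so s <= t <= Num.max so s -> is_derive t 1 U (u t)) ->
  (forall t, Num.min so s <= t <= Num.max so s ->
     `|u t| <= K * (k * expR (k * `|t - so|))) ->
  `|U s| <= K * expR (k * `|s - so|).
Proof.
move=> K0 U0 dU uk; have [sos|/ltW sso] := leP so s.
  rewrite (min_idPl sos) (max_idPr sos) in dU uk.
  rewrite [`|s - so|]ger0_norm ?subr_ge0//.
  have := @increment_le U (fun t => K * expR (k * (t - so))) u
    (fun t => K * (k * expR (k * (t - so)))) so s sos dU.
  rewrite U0 subr0 subrr mulr0 expR0 mulr1 => h.
  apply: le_trans (h _ _) _; last by rewrite gerBl.
  - by move=> t _; exact: is_derive_expR_affine.
  - move=> t ts; have := uk t ts; rewrite [`|t - so|]ger0_norm// subr_ge0.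
    by case/andP: ts.
rewrite (min_idPr sso) (max_idPl sso) in dU uk.
rewrite [`|s - so|]ler0_norm ?subr_le0// opprB.
have := @increment_le U (fun t => - K * expR (- k * (t - so))) u
  (fun t => - K * (- k * expR (- k * (t - so)))) s so sso dU.
rewrite U0 sub0r normrN subrr mulr0 expR0 mulr1 => h.
apply: le_trans (h _ _) _.
- by move=> t _; exact: is_derive_expR_affine.
- move=> t ts; have := uk t ts.
  rewrite [`|t - so|]ler0_norm ?subr_le0; last by case/andP: ts.
  by rewrite !mulNr !mulrN opprK.
- by rewrite mulNr opprK mulNr -mulrN opprB; lra.
Qed.

Lemma geometric_small (K e : R) : 0 < e -> exists n, K / 2 ^+ n < e.
Proof.
move=> e0.
have : geometric K 2^-1 @ \oo --> 0.
  by apply: cvg_geometric; rewrite gtr0_norm ?invr_gt0// invf_lt1// ltr1n.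
move/cvgrPdist_lt => /(_ e e0)[N _ /(_ N (leqnn N))].
rewrite /= sub0r normrN exprVn => h; exists N.
exact: le_lt_trans (ler_norm _) h.
Qed.

Lemma bounded_on_segment f (a b : R) : a <= b ->
  (forall s, a <= s <= b -> {for s, continuous f}) ->
  exists2 C : R, 0 < C & forall s, a <= s <= b -> f s <= C.
Proof.
move=> ab fc; have [|c _ fC] := @EVT_max R f a b ab.
  by apply: continuous_in_subspaceT => x; rewrite inE/= in_itv/= => /fc.
exists (`|f c| + 1) => [|s sab]; first by rewrite ltr_wpDl.
by apply: le_trans (fC s _) _; rewrite ?in_itv//= ler_wpDr// ler_norm.
Qed.

End real_line.

(** * Global solutions of equations with a Lipschitz right-hand side *)

Section picard.
Context {R : realType}.
Variables (I : set R) (so x0 : R) (F : R -> R -> R) (L : R -> R).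
Hypotheses (oI : open_interval I) (Iso : I so).
Hypothesis Fc : forall x s, I s -> {for s, continuous (F^~ x)}.
Hypothesis Lc : forall s, I s -> {for s, continuous L}.
Hypothesis FL : forall s x y, I s -> `|F s x - F s y| <= L s * `|x - y|.

Implicit Types th : R -> R.

Let continuous_on th := forall s, I s -> {for s, continuous th}.

(** Continuity of [F] in each variable suffices, since the Lipschitz constants
    [L t] stay bounded near [s]. *)
Lemma field_along_continuous th : continuous_on th ->
  continuous_on (fun t => F t (th t)).
Proof.
move=> thc s Is.
suff : (fun t => F t (th s) + (F t (th t) - F t (th s))) @ s --> F s (th s) + 0.
  rewrite addr0; under eq_fun do rewrite addrC subrK; exact.
apply: cvgD; first exact: Fc.
have Lth : (fun t => L t * `|th t - th s|) @ s --> 0.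
  rewrite -[X in _ --> X](mulr0 (L s)) -(normr0 R) -(subrr (th s)).
  apply: cvgM; first exact: Lc.
  by apply: cvg_norm; apply: cvgB; [exact: thc|exact: cvg_cst].
have NLth : (fun t => - (L t * `|th t - th s|)) @ s --> 0.
  by rewrite -[X in _ --> X]oppr0; exact: cvgN.
apply: (squeeze_cvgr _ NLth Lth); near=> t; rewrite -ler_norml; apply: FL.
by near: t; apply: open_nbhs_nbhs; split => //; case: oI.
Unshelve. all: by end_near. Qed.

Definition picard th : R -> R := fun s => x0 + primitive so (fun t => F t (th t)) s.

Lemma picard_start th : picard th so = x0.
Proof. by rewrite /picard primitive_start addr0. Qed.

Lemma picard_derive th s : continuous_on th -> I s ->
  is_derive s 1 (picard th) (F s (th s)).
Proof.
move=> thc Is; rewrite -[X in is_derive _ _ _ X]add0r; apply: is_deriveD.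
exact: primitive_derive oI (field_along_continuous thc) Iso Is.
Qed.

Lemma picard_continuous th : continuous_on th -> continuous_on (picard th).
Proof. by move=> thc s Is; apply: is_derive1_continuous (picard_derive thc Is). Qed.

Section segment.
Variables (a b M : R).
Hypotheses (aso : a <= so) (sob : so <= b) (abI : forall s, a <= s <= b -> I s).
Hypothesis LM : forall s, a <= s <= b -> L s <= M.

(** The contraction property in Bielecki's weighted norm: the Lipschitz bound
    costs a factor [M], integrating the weight gains a factor [1 / (2 * M)]. *)
Lemma picard_contract th1 th2 (C : R) :
  continuous_on th1 -> continuous_on th2 -> 0 <= C ->
  (forall t, a <= t <= b ->
     `|th1 t - th2 t| <= C * expR (2 * M * `|t - so|)) ->
  forall s, a <= s <= b ->
    `|picard th1 s - picard th2 s| <= C / 2 * expR (2 * M * `|s - so|).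
Proof.
move=> th1c th2c C0 th12 s /andP[as_ sb].
have inab t : Num.min so s <= t <= Num.max so s -> a <= t <= b.
  move=> /andP[h1 h2]; apply/andP; split.
    by apply: le_trans h1; rewrite le_min aso.
  by apply: le_trans h2 _; rewrite ge_max sob.
apply: (@exp_increment_le _ (picard th1 - picard th2)
  (fun t => F t (th1 t) - F t (th2 t)) so s (2 * M) (C / 2)).
- by rewrite divr_ge0.
- by rewrite -[LHS]/(picard th1 so - picard th2 so) !picard_start subrr.
- by move=> t /inab/abI It; apply: is_deriveB; exact: picard_derive.
- move=> t /inab tab; apply: le_trans (FL _ _ (abI tab)) _.
  apply: (@le_trans _ _ (M * (C * expR (2 * M * `|t - so|)))).
    apply: ler_pM => //; [|exact: LM|exact: th12].
    have := FL 1 0 (abI tab); rewrite subr0 normr1 mulr1.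
    exact: le_trans.
  by rewrite le_eqVlt; apply/orP; left; apply/eqP; field.
Qed.

End segment.

Let iterate n := iter n picard (cst x0).

Let iterate_continuous n : continuous_on (iterate n).
Proof.
elim: n => [|n IH]; last exact: picard_continuous.
by move=> s _; exact: cst_continuous.
Qed.

(** Defined pointwise, so that it does not depend on a compact subinterval. *)
Let limit (s : R) : R := limn (iterate ^~ s).

Let limit_bound a b : a <= so <= b -> (forall s, a <= s <= b -> I s) ->
  exists2 K : R, 0 <= K & forall n s, a <= s <= b ->
    `|limit s - iterate n s| <= K / 2 ^+ n.
Proof.
move=> /andP[aso sob] abI; have ab := le_trans aso sob.
have [M M0 LM] := bounded_on_segment ab (fun s sab => Lc (abI s sab)).
have [C C0 iterC] : exists2 C : R, 0 < C & forall s, a <= s <= b ->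
    `|iterate 1 s - iterate 0 s| <= C.
  apply: bounded_on_segment => // s /abI Is.
  by apply: cvg_norm; apply: cvgB; exact: iterate_continuous.
have step n s : a <= s <= b -> `|iterate n.+1 s - iterate n s| <=
    C / 2 ^+ n * expR (2 * M * `|s - so|).
  elim: n s => [|n IH] s sab.
    rewrite expr0 divr1; apply: le_trans (iterC s sab) _.
    by rewrite ler_peMr ?(ltW C0)// -expR0 ler_expR !mulr_ge0// ltW.
  rewrite exprSr invfM mulrA.
  rewrite -[iterate n.+2 s]/(picard (iterate n.+1) s).
  rewrite -[X in _ - X]/(picard (iterate n) s).
  apply: (picard_contract aso sob abI LM (@iterate_continuous n.+1)
    (@iterate_continuous n) _ IH sab).
  by rewrite divr_ge0 ?exprn_ge0// ltW.
pose K := C * expR (2 * M * (b - a)).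
have K0 : 0 <= K by rewrite mulr_ge0 ?expR_ge0// ltW.
exists (2 * K) => [|n s sab]; first by rewrite mulr_ge0.
have [m|l lP] := @geometric_limit _ (iterate ^~ s) K.
  apply: le_trans (step m s sab) _; rewrite mulrAC ler_pM2r ?invr_gt0 ?exprn_gt0//.
  rewrite ler_pM2l// ler_expR ler_pM2l ?mulr_gt0//.
  by case/andP: sab => h1 h2; rewrite ler_norml; apply/andP; split; lra.
suff -> : limit s = l by exact: lP.
apply: cvg_lim; first exact: Rhausdorff.
apply/cvgrPdist_lt => e e0.
have [N KN] := geometric_small (2 * K) e0.
exists N => // m /= Nm; apply: le_lt_trans (lP m) _; apply: le_lt_trans KN.
apply: ler_wpM2l; first by rewrite mulr_ge0.
by rewrite lef_pV2 ?posrE ?exprn_gt0// ler_weXn2l ?ler1n.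
Qed.

Let limit_continuous : continuous_on limit.
Proof.
move=> s Is.
have [a [b [aso as_ abI]]] := open_interval_widen oI Iso Is.
have [|K K0 limK] := @limit_bound a b _ abI.
  by case/andP: aso => *; rewrite !ltW.
apply/cvgrPdist_lt => e e0.
have [|n Kn] := @geometric_small R K (e / 3); first by rewrite divr_gt0.
have near_it : \forall t \near s, `|iterate n s - iterate n t| < e / 3.
  have /cvgrPdist_lt := @iterate_continuous n s Is.
  by apply; rewrite divr_gt0.
have [as_lt s_lt_b] := andP as_.
near=> t.
have tab : a <= t <= b.
  by apply/andP; split; apply/ltW; near: t; [exact: lt_nbhsr|exact: lt_nbhsl].
have h1 : `|limit s - iterate n s| < e / 3.
  by apply: le_lt_trans Kn; apply: limK; case/andP: as_ => *; rewrite !ltW.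
have h2 : `|limit t - iterate n t| < e / 3 by exact: le_lt_trans (limK _ _ tab) Kn.
have h3 : `|iterate n s - iterate n t| < e / 3 by near: t.
by move: h1 h2 h3; rewrite !ltr_norml => /andP[? ?] /andP[? ?] /andP[? ?];
  apply/andP; split; lra.
Unshelve. all: by end_near. Qed.

(** Both [picard limit] and [limit] are limits of the iterates, the former by
    [picard_contract]. *)
Let limit_fixed s : I s -> picard limit s = limit s.
Proof.
move=> Is; apply/eqP; rewrite -subr_eq0 -normr_eq0 eq_le normr_ge0 andbT.
have [a [b [/andP[/ltW a1 /ltW b1] /andP[/ltW a2 /ltW b2] abI]]] :=
  open_interval_widen oI Iso Is.
have [M M0 LM] :=
  bounded_on_segment (le_trans a1 b1) (fun s sab => Lc (abI s sab)).
have [|K K0 limK] := @limit_bound a b _ abI; first by rewrite a1.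
have sab : a <= s <= b by rewrite a2.
pose E := expR (2 * M * `|s - so|).
rewrite leNgt; apply/negP => d0.
have [n] := geometric_small (K * E + K) d0; apply/negP; rewrite -leNgt.
have h1 : `|limit s - iterate n.+1 s| <= K / 2 ^+ n.
  apply: le_trans (limK n.+1 s sab) _; apply: ler_wpM2l => //.
  by rewrite lef_pV2 ?posrE ?exprn_gt0// ler_weXn2l ?ler1n.
have h2 : `|picard limit s - iterate n.+1 s| <= K / 2 ^+ n / 2 * E.
  apply: (picard_contract a1 b1 abI LM limit_continuous
    (@iterate_continuous n) _ _ sab); first by rewrite divr_ge0 ?exprn_ge0.
  move=> t tab; apply: le_trans (limK n t tab) _.
  by rewrite ler_peMr ?divr_ge0 ?exprn_ge0// -expR0 ler_expR !mulr_ge0// ltW.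
have h3 : K / 2 ^+ n / 2 * E <= K * E / 2 ^+ n.
  rewrite (_ : K / _ / 2 * E = K * E / 2 ^+ n / 2); last by ring.
  by rewrite ler_piMr ?divr_ge0 ?mulr_ge0 ?expR_ge0 ?exprn_ge0// invf_le1// ler1n.
rewrite (_ : _ - _ = (picard limit s - iterate n.+1 s)
  - (limit s - iterate n.+1 s)); last by ring.
by apply: le_trans (ler_normB _ _) _; rewrite mulrDl lerD// (le_trans h2).
Qed.

(** The Lipschitz condition holds for all values of the unknown, so the solution
    cannot blow up inside [I], however [L] behaves at the ends of [I]. *)
Lemma lipschitz_ode_solution : exists th : R -> R,
  th so = x0 /\ forall s, I s -> is_derive s 1 th (F s (th s)).
Proof.
exists (picard limit); split=> [|s Is]; first exact: picard_start.
by rewrite limit_fixed//; exact: picard_derive.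
Qed.

End picard.

(** * The hyperbolic tangent and the first-order equation for the slope *)

Section tanh.
Context {R : realType}.
Implicit Types x y : R.

(** A form of [sinh x / cosh x] with a single exponential. *)
Definition tanh x : R := 1 - 2 / (expR (2 * x) + 1).

Lemma one_sub_tanh2 x :
  1 - tanh x ^+ 2 = 4 * expR (2 * x) / (expR (2 * x) + 1) ^+ 2.
Proof.
rewrite /tanh; have := expR_gt0 (2 * x); move: (expR _) => E E0; field.
by rewrite gt_eqF//; lra.
Qed.

Lemma is_derive_tanh x : is_derive x 1 tanh (1 - tanh x ^+ 2).
Proof.
have dE : is_derive x 1 (fun y => expR (2 * y)) (2 * expR (2 * x)).
  have := is_derive_expR_affine 2 0 1 x.
  by rewrite subr0 mul1r; under eq_fun do rewrite subr0 mul1r.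
have E0 := expR_gt0 (2 * x).
have E1 : expR (2 * x) + 1 != 0 by rewrite gt_eqF//; lra.
have dE1 : is_derive x 1 (fun y => expR (2 * y) + 1) (2 * expR (2 * x)).
  by rewrite -[X in is_derive _ _ _ X]addr0; exact: is_deriveD.
have dV : is_derive x 1 (fun y => (expR (2 * y) + 1)^-1)
    (- (expR (2 * x) + 1) ^- 2 * (2 * expR (2 * x))).
  have [E1d E1e] := dE1; apply: DeriveDef; first exact: derivableV.
  by rewrite deriveV// E1e.
have dT : is_derive x 1 tanh
    (0 - 2 * (- (expR (2 * x) + 1) ^- 2 * (2 * expR (2 * x)))).
  by apply: is_deriveB; exact: is_deriveZ dV.
apply: is_derive_eq dT _; rewrite one_sub_tanh2.
by move: (expR _) E1 => E E1; field.
Qed.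

Lemma tanh_lipschitz x y : `|tanh x - tanh y| <= `|x - y|.
Proof.
wlog le_yx : x y / y <= x => [h|].
  have [|/ltW xy] := leP y x; first exact: h.
  by rewrite distrC [leRHS]distrC; exact: h.
rewrite [leRHS]ger0_norm ?subr_ge0//.
apply: (@increment_le _ tanh id (fun z => 1 - tanh z ^+ 2) (cst 1)) => // z _.
  exact: is_derive_tanh.
rewrite ger0_norm; first by rewrite gerBl sqr_ge0.
by rewrite one_sub_tanh2 divr_ge0 ?sqr_ge0// mulr_ge0 ?expR_ge0.
Qed.

Lemma tanh_surjective (w : R) : -1 < w < 1 -> exists x, tanh x = w.
Proof.
move=> /andP[w1 w2]; exists (ln ((1 + w) / (1 - w)) / 2).
rewrite /tanh.
have -> : 2 * (ln ((1 + w) / (1 - w)) / 2) = ln ((1 + w) / (1 - w)) by field.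
rewrite lnK; last by rewrite posrE divr_gt0//; lra.
by field; apply/andP; split; rewrite gt_eqF//; lra.
Qed.

End tanh.

(** The barriers [w = 1] and [w = -1] are sent to infinity by [w = tanh th], and
    the factor [1 - w ^+ 2], which is the derivative of [tanh] at [th], cancels. *)
Lemma abel_ode_solution (R : realType) (I : set R) (h : R -> R) (sigma so w0 : R) :
  open_interval I -> I so -> (forall s, I s -> {for s, continuous h}) ->
  -1 < w0 < 1 ->
  exists w : R -> R, w so = w0 /\ forall s, I s ->
    is_derive s 1 w (sigma * (1 - w s ^+ 2) * (1 - w s * h s)).
Proof.
move=> oI Iso hc /tanh_surjective[x0 tanh_x0].
have [|||th [th0 dth]] := @lipschitz_ode_solution R I so x0
  (fun s x => sigma * (1 - tanh x * h s)) (fun s => `|sigma| * `|h s|) oI Iso.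
- move=> x s Is; apply: cvgM; first exact: cvg_cst.
  by apply: cvgB; [exact: cvg_cst|apply: cvgM; [exact: cvg_cst|exact: hc]].
- move=> s Is; apply: cvgM; first exact: cvg_cst.
  by apply: cvg_norm; exact: hc.
- move=> s x y _; rewrite -mulrBr opprB addrC addrA subrK -mulrBl.
  rewrite !normrM -mulrA ler_wpM2l// mulrC ler_wpM2l// distrC.
  exact: tanh_lipschitz.
exists (tanh \o th); split=> [|s Is]; first by rewrite /= th0.
have dT := is_derive_tanh (th s).
have dw := is_derive1_comp dT (dth s Is).
by apply: is_derive_eq dw _; rewrite /=; ring.
Qed.

(** * Continuity of the divergence of the gradient as a function of the level *)

Section level_function.
Context {R : realType} {n : nat} {M : topologicalType} {A : manifold R M n}.
Variables (g : semi_riemannian A) (f : M -> R).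

(** [g(grad f, grad f)] is the derivative of [f] in the direction of its own
    gradient. *)
Lemma partial_neq0 (c : chart R M n) x : atlas A c -> cimg c x ->
  bilin (metric g c x) (grad g f c x) (grad g f c x) != 0 ->
  exists j, partial j (f \o cinv c) x != 0.
Proof.
move=> Ac cx; rewrite (grad_metric g f _ Ac cx) => /eqP df.
apply: contrapT => no_j; apply: df; apply: big1 => j _.
suff -> : partial j (f \o cinv c) x = 0 by rewrite mul0r.
by apply: contrapT => /eqP dj; apply: no_j; exists j.
Qed.

(** The coordinate line through [p] along which [f] has a nonzero derivative is
    a curve to which [continuous_from_curve] applies. *)
Lemma divergence_factor_continuous (h : R -> R) (p : M) :
  smooth_fun A f ->
  (forall c x, atlas A c -> cimg c x ->
     bilin (metric g c x) (grad g f c x) (grad g f c x) != 0) ->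
  (forall c x, atlas A c -> cimg c x ->
     divergence g (grad g f) c x = h (f (cinv c x))) ->
  {for f p, continuous h}.
Proof.
move=> fs gradn0 divh; have [c Ac cp] := atlas_cover A p.
pose x := cmap c p; have cx : cimg c x by exists p.
have cimgo : open (cimg c) := @cimg_open _ _ _ c.
have [j dj] := partial_neq0 Ac cx (gradn0 c x Ac cx).
pose F := f \o cinv c; have F1 : Ck_on 1 (cimg c) F := fs c Ac 1%N.
pose line (t : R) := t *: (delta_mx 0 j : 'rV[R]_n) + x.
have line0 : line 0 = x by rewrite /line scale0r add0r.
have linec t : {for t, continuous line}.
  by apply: cvgD; [apply: cvgZr_tmp; exact: cvg_id|exact: cvg_cst].
have near_line : \forall t \near 0, cimg c (line t).
  by apply: (linec 0); rewrite line0; exact: near_open.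
have -> : f p = (F \o line) 0 by rewrite /= line0 /F/= cmapK.
apply: (continuous_from_curve dj).
- rewrite /= line0.
  have [dF _] := Ck1_is_derive j F1 cx.
  exact: dF.
- near=> t; apply: continuous_comp; first exact: linec.
  by apply: Ck1_continuous F1 _; near: t.
- apply: (@continuous_at_near _ _ _ (fun t => divergence g (grad g f) c (line t))).
    by near=> t; rewrite /= divh//; near: t.
  apply: continuous_comp; first exact: linec.
  rewrite line0; apply: (divergence_continuous Ac _ cx) => k.
  exact: (@grad_Ck1 _ _ _ _ g c Ac f k (fs c Ac 2%N)).
Unshelve. all: by end_near. Qed.

End level_function.

(** * Solutions defined on the whole interval *)

Theorem corollary5 (R : realType)
    (n : nat) (M : topologicalType) (A : manifold R M n)
    (g : semi_riemannian A)
    (k : nat) (Sigma : groupSpaceType) (L : lie_group R Sigma k)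
    (act : Sigma -> M -> M)
    (I : set R) (prj : M -> R) (h : R -> R) (epst eps : R) :
  connected [set: M] ->
  open_interval I ->
  smooth_action L A act ->
  (forall a : Sigma, metric_isometry g (act a)) ->
  submersion_onto A I prj ->
  (forall s, I s -> exists p, prj @^-1` [set s] = act_orbit act p) ->
  (epst = 1 \/ epst = -1) ->
  (forall c x, atlas A c -> cimg c x ->
     bilin (metric g c x) (grad g prj c x) (grad g prj c x) = epst) ->
  (forall c x, atlas A c -> cimg c x ->
     divergence g (grad g prj) c x = h (prj (cinv c x))) ->
  (eps = 1 \/ eps = -1) ->
  eps * epst = -1 ->
  forall so f1 fo : R, I so -> -1 < f1 < 1 ->
  exists f : R -> R,
    [/\ forall s, I s ->
          [/\ derivable f s 1,
              derivable (derive1 f) s 1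
            & derive1 (derive1 f) s =
              (epst + eps * derive1 f s ^+ 2) * (1 - derive1 f s * h s)],
        f so = fo
      & derive1 f so = f1].
Proof.
move=> _ oI _ _ [prj_smooth prj_onto _] _ epst1 gradE divE _ eps_epst.
move=> so f1 fo Iso f1_bound.
have epst0 : epst != 0 by case: epst1 => ->; rewrite ?oppr_eq0 oner_eq0.
have hc s : I s -> {for s, continuous h}.
  rewrite -prj_onto => -[p _ <-].
  apply: (@divergence_factor_continuous _ _ _ _ g prj h p prj_smooth _ divE).
  by move=> c x Ac cx; rewrite gradE.
have [w [w_so dw]] := abel_ode_solution epst oI Iso hc f1_bound.
have wc s : I s -> {for s, continuous w}.
  by move=> Is; exact: is_derive1_continuous (dw s Is).
pose f s := fo + primitive so w s.
have df s : I s -> is_derive s 1 f (w s).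
  move=> Is; rewrite -[w s]add0r; apply: is_deriveD.
  exact: primitive_derive oI wc Iso Is.
have df1 s : I s -> derive1 f s = w s.
  by move=> /df[_ dfs]; rewrite derive1E.
have ddf s : I s ->
    is_derive s 1 (derive1 f) (epst * (1 - w s ^+ 2) * (1 - w s * h s)).
  move=> Is; apply: near_eq_is_derive (dw s Is).
  have [Io _] := oI; near=> t; apply/esym/df1; near: t.
  by apply: open_nbhs_nbhs.
exists f; split; last by rewrite df1.
- move=> s Is; split; first by have [] := df s Is.
    by have [] := ddf s Is.
  rewrite derive1E; have [_ ->] := ddf s Is; rewrite df1//; congr (_ * _).
  (* As epst ^+ 2 = 1, the relation eps * epst = -1 says that eps = - epst. *)
  have -> : eps = - epst.
    by case: epst1 eps_epst => ->; rewrite ?mulr1 ?mulrN1 ?opprK// => /oppr_inj.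
  by ring.
- by rewrite /f primitive_start addr0.
Unshelve. all: by end_near. Qed.
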